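(* Let $k\in\mathbb{Z}$ and let $\nu\in\mathbb{R}$ with $\nu\neq 0$. For all integers $n\ge 0$ and $r\ge 0$, as polynomials in $x$, $$HB_{n}^{(\nu,k)}(x)=\sum_{m=0}^{n}\left\{\binom{n}{m}\sum_{l=0}^{n-m}\frac{\binom{n-m}{l}}{\binom{l+r}{r}}S_{2}(l+r,r)\,HB_{n-m-l}^{(\nu,k)}\right\}\mathbb{B}_{m}^{(r)}(x).$$
   Context: For $k\in\mathbb{Z}$ the polylogarithm is the power series $\mathrm{Li}_k(x)=\sum_{n=1}^{\infty}\frac{x^n}{n^k}$. All generating functions below are formal power series in $t$. $S_2(n,m)$ denotes the Stirling number of the second kind. For an integer $r\ge 0$, the Bernoulli polynomials $\mathbb{B}_n^{(r)}(x)$ of order $r$ are defined by $$\left(\frac{t}{e^t-1}\right)^r e^{xt}=\sum_{n=0}^{\infty}\mathbb{B}_n^{(r)}(x)\frac{t^n}{n!}.$$ For real $\nu\neq 0$, the Hermite and poly-Bernoulli mixed-type polynomials $HB_n^{(\nu,k)}(x)$ are defined by $$e^{-\frac{\nu t^2}{2}}\,\frac{\mathrm{Li}_k(1-e^{-t})}{1-e^{-t}}\,e^{xt}=\sum_{n=0}^{\infty}HB_n^{(\nu,k)}(x)\frac{t^n}{n!},$$ and $HB_n^{(\nu,k)}=HB_n^{(\nu,k)}(0)$ are the Hermite and poly-Bernoulli mixed-type numbers. *)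

(* Defs.v *)
From HB Require Import structures.
From mathcomp Require Import all_boot all_order all_algebra.
From mathcomp Require Import boolp classical_sets reals.

Set Implicit Arguments.
Unset Strict Implicit.
Unset Printing Implicit Defensive.

Import Order.TTheory GRing.Theory Num.Theory.
Local Open Scope ring_scope.

Record fps (A : Type) := Fps { fps_coef :> nat -> A }.

Lemma fpsP (A : Type) (f g : fps A) : f =1 g -> f = g.
Proof. by case: f => f; case: g => g /= /funext ->. Qed.

HB.instance Definition _ (A : Type) := gen_eqMixin (fps A).
HB.instance Definition _ (A : Type) := gen_choiceMixin (fps A).

Section FpsRing.
Variable A : comNzRingType.
Implicit Types f g h : fps A.

Definition fps_const (a : A) : fps A := Fps (fun n => a *+ (n == 0)%N).
Definition fps_add f g : fps A := Fps (fun n => f n + g n).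
Definition fps_opp f : fps A := Fps (fun n => - f n).
Definition fps_mul f g : fps A :=
  Fps (fun n => \sum_(i < n.+1) f i * g (n - i)%N).

Fact fps_addA : associative fps_add.
Proof. by move=> f g h; apply: fpsP => n /=; rewrite addrA. Qed.
Fact fps_addC : commutative fps_add.
Proof. by move=> f g; apply: fpsP => n /=; rewrite addrC. Qed.
Fact fps_add0 : left_id (fps_const 0) fps_add.
Proof. by move=> f; apply: fpsP => n /=; rewrite mul0rn add0r. Qed.
Fact fps_addN : left_inverse (fps_const 0) fps_opp fps_add.
Proof. by move=> f; apply: fpsP => n /=; rewrite mul0rn addNr. Qed.

HB.instance Definition _ :=
  GRing.isZmodule.Build (fps A) fps_addA fps_addC fps_add0 fps_addN.

Definition fps_trunc N f : {poly A} := \poly_(i < N.+1) f i.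

Lemma coef_fps_trunc N f i : (i <= N)%N -> (fps_trunc N f)`_i = f i.
Proof. by move=> iN; rewrite coef_poly ltnS iN. Qed.

Lemma fps_mul_trunc N f g n : (n <= N)%N ->
  fps_mul f g n = (fps_trunc N f * fps_trunc N g)`_n.
Proof.
move=> nN; rewrite coefM; apply: eq_bigr => i _.
by rewrite !coef_fps_trunc ?(leq_trans (leq_subr _ _)) ?(leq_trans (leq_ord i)).
Qed.

Fact fps_mulA : associative fps_mul.
Proof.
move=> f g h; apply: fpsP => n.
transitivity (fps_trunc n f * fps_trunc n g * fps_trunc n h)`_n.
  rewrite -mulrA coefM; apply: eq_bigr => i _.
  by rewrite coef_fps_trunc ?leq_ord// (fps_mul_trunc _ _ (leq_subr i n)).
rewrite coefM; apply: eq_bigr => i _.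
by rewrite (@fps_mul_trunc n) ?leq_ord// (coef_fps_trunc _ (leq_subr i n)).
Qed.
Fact fps_mulC : commutative fps_mul.
Proof.
by move=> f g; apply: fpsP => n; rewrite !(@fps_mul_trunc n)// mulrC.
Qed.
Fact fps_mul1 : left_id (fps_const 1) fps_mul.
Proof.
move=> f; apply: fpsP => n /=; rewrite big_ord_recl /= mulr1n mul1r subn0.
by rewrite big1 ?addr0// => i _; rewrite mul0r.
Qed.
Fact fps_mulDl : left_distributive fps_mul fps_add.
Proof.
move=> f g h; apply: fpsP => n /=; rewrite -big_split.
by apply: eq_bigr => i _; rewrite mulrDl.
Qed.
Fact fps_1neq0 : fps_const 1 != 0.
Proof.
apply/eqP => /(congr1 (fun f => fps_coef f 0%N)) /= /eqP.
by rewrite mulr1n oner_eq0.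
Qed.

HB.instance Definition _ :=
  GRing.Zmodule_isComNzRing.Build (fps A)
    fps_mulA fps_mulC fps_mul1 fps_mulDl fps_1neq0.

Lemma fps_coefD f g n : (f + g) n = f n + g n. Proof. by []. Qed.
Lemma fps_coefN f n : (- f) n = - f n. Proof. by []. Qed.
Lemma fps_coef0 n : (0 : fps A) n = 0. Proof. exact: mul0rn. Qed.
Lemma fps_coef1 n : (1 : fps A) n = (n == 0%N)%:R. Proof. by []. Qed.
Lemma fps_coefM f g n : (f * g) n = \sum_(i < n.+1) f i * g (n - i)%N.
Proof. by []. Qed.

Definition fps_t : fps A := Fps (fun n => (n == 1)%N%:R).

(* [f(g(t))]; meaningful when [g] has no constant term, so that [g ^+ i] does
   not contribute to the coefficient of [t^n] for [i > n]. *)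
Definition fps_comp f g : fps A :=
  Fps (fun n => \sum_(i < n.+1) f i * (g ^+ i) n).

(* [f / g] as the series [q] with [q * g = f] (and 0 if there is none); [g] need
   not be invertible as a power series.  See [fps_divK] and [fps_divP]. *)
Definition fps_div f g : fps A := xget 0 [set q | q * g = f]%classic.

(* [g n] when [f = \sum_n g_n t^n / n!] *)
Definition egf_coef f (n : nat) : A := f n *+ n`!.

End FpsRing.

Arguments fps_t {A}.

Definition fps_map (A B : Type) (phi : A -> B) (f : fps A) : fps B :=
  Fps (fun n => phi (f n)).

Section FpsDiv.
Variable F : fieldType.
Implicit Types f g q : fps F.

Fixpoint fps_quot_seq f g n : seq F :=
  if n is m.+1 then
    let s := fps_quot_seq f g m in
    rcons s ((f m.+1 - \sum_(i < m) s`_i * g (m.+1 - i)%N) / g 1%N)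
  else [::].

Lemma size_fps_quot_seq f g n : size (fps_quot_seq f g n) = n.
Proof. by elim: n => //= n IHn; rewrite size_rcons IHn. Qed.

Lemma nth_fps_quot_seq f g n i : (i < n)%N ->
  (fps_quot_seq f g n)`_i = (fps_quot_seq f g i.+1)`_i.
Proof.
elim: n => // n IHn; rewrite ltnS leq_eqVlt => /orP[/eqP -> //|lt_in].
by rewrite [LHS]/= nth_rcons size_fps_quot_seq lt_in IHn.
Qed.

Lemma fps_divK f g : f 0%N = 0 -> g 0%N = 0 -> g 1%N != 0 ->
  fps_div f g * g = f.
Proof.
move=> f0 g0 g1; rewrite /fps_div; apply: (@xgetPex _ 0 [set q | q * g = f]%classic).
exists (Fps (fun n => (fps_quot_seq f g n.+1)`_n)) => /=.
apply: fpsP => -[|n]; rewrite fps_coefM.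
  by rewrite big_ord1 g0 mulr0 f0.
rewrite big_ord_recr /= subnn g0 mulr0 addr0 big_ord_recr /= subSnn.
rewrite nth_rcons size_fps_quot_seq ltnn eqxx divfK//.
rewrite [X in X + _](eq_bigr (fun i : 'I_n =>
  (fps_quot_seq f g n)`_i * g (n.+1 - i)%N)) ?subrKC// => i _.
by rewrite [in RHS]nth_fps_quot_seq.
Qed.

Lemma fps_mul_inj g q q' : g 0%N = 0 -> g 1%N != 0 -> q * g = q' * g -> q = q'.
Proof.
move=> g0 g1 /eqP; rewrite -subr_eq0 -mulrBl => /eqP qq'.
apply/eqP; rewrite -subr_eq0; apply/eqP; move: (q - q') qq' => d dg.
apply: fpsP => n; rewrite fps_coef0.
elim/ltn_ind: n => n IHn; have : (d * g) n.+1 = 0 by rewrite dg fps_coef0.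
rewrite fps_coefM 2!big_ord_recr /= subnn g0 mulr0 addr0 subSnn.
rewrite big1 ?add0r => [/eqP|i _]; last by rewrite IHn ?mul0r.
by rewrite mulf_eq0 (negPf g1) orbF => /eqP.
Qed.

Lemma fps_divP f g q : g 0%N = 0 -> g 1%N != 0 -> q * g = f -> fps_div f g = q.
Proof.
move=> g0 g1 qg; apply: (fps_mul_inj g0 g1); rewrite fps_divK ?qg//.
by rewrite -qg fps_coefM big_ord1 g0 mulr0.
Qed.

End FpsDiv.

Section Polynomials.
Variable R : realType.

Definition expt : fps R := Fps (fun n => n`!%:R^-1).

Definition fps_exp (f : fps R) : fps R := fps_comp expt f.

(* [e^{xt}], with coefficients in [R[x]] *)
Definition exp_xt : fps {poly R} :=
  fps_comp (fps_map polyC expt) (fps_const 'X * fps_t).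

Definition polylog (k : int) : fps R :=
  Fps (fun n => if n == 0%N then 0 else (n%:R ^ k)^-1).

(* [(t / (e^t - 1))^r e^{xt}] *)
Definition bernoulli_gf (r : nat) : fps {poly R} :=
  fps_map polyC (fps_div fps_t (fps_exp fps_t - 1) ^+ r) * exp_xt.

Definition bernoulli_poly (r n : nat) : {poly R} := egf_coef (bernoulli_gf r) n.

(* [e^{-nu t^2 / 2} (Li_k(1 - e^{-t}) / (1 - e^{-t})) e^{xt}] *)
Definition hermite_polyBernoulli_gf (nu : R) (k : int) : fps {poly R} :=
  fps_map polyC
    (fps_exp (- (fps_const (nu / 2) * fps_t ^+ 2)) *
     fps_div (fps_comp (polylog k) (1 - fps_exp (- fps_t)))
             (1 - fps_exp (- fps_t)))
  * exp_xt.

Definition hermite_polyBernoulli (nu : R) (k : int) (n : nat) : {poly R} :=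
  egf_coef (hermite_polyBernoulli_gf nu k) n.

Definition hermite_polyBernoulli_num (nu : R) (k : int) (n : nat) : R :=
  (hermite_polyBernoulli nu k n).[0].

Lemma fps_exp_coef0 (f : fps R) : fps_exp f 0%N = 1.
Proof. by rewrite /= big_ord1 expr0 fps_coef1 fact0 invr1 mulr1. Qed.

Lemma fps_exp_coef1 (f : fps R) : fps_exp f 1%N = f 1%N.
Proof.
rewrite /fps_exp /fps_comp [LHS]/fps_coef big_ord_recr big_ord1 expr0 expr1.
by rewrite fps_coef1 mulr0 /= add0r invr1 mul1r.
Qed.

Lemma bernoulli_quotK :
  fps_div fps_t (fps_exp fps_t - 1) * (fps_exp fps_t - 1) = fps_t :> fps R.
Proof.
apply: fps_divK; rewrite ?fps_coefD ?fps_coefN ?fps_coef1 //.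
  by rewrite fps_exp_coef0 subrr.
by rewrite fps_exp_coef1 subr0 oner_neq0.
Qed.

Lemma polyBernoulli_quotK (k : int) :
  fps_div (fps_comp (polylog k) (1 - fps_exp (- fps_t))) (1 - fps_exp (- fps_t))
    * (1 - fps_exp (- fps_t)) = fps_comp (polylog k) (1 - fps_exp (- fps_t)).
Proof.
apply: fps_divK; first by rewrite /= big_ord1 mul0r.
  by rewrite fps_coefD fps_coefN fps_exp_coef0 fps_coef1 subrr.
rewrite fps_coefD fps_coefN fps_exp_coef1 fps_coefN fps_coef1.
by rewrite opprK add0r oner_neq0.
Qed.

End Polynomials.

Arguments bernoulli_poly : clear implicits.

(* Stirling number of the second kind: the number of partitions of an
   [n]-element set into [m] nonempty blocks. *)
Definition stirling2 (n m : nat) : nat :=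
  #|[set P : {set {set 'I_n}} | finset.partition P [set: 'I_n] & #|P| == m]|.

(* Main.v *)
Require Import Defs.
From mathcomp Require Import all_boot all_order all_algebra.
From mathcomp Require Import reals zify ring.

Import Order.TTheory GRing.Theory Num.Theory.
Local Open Scope ring_scope.

(** The exponential generating function of [HB_n(x)] is [A * e^{xt}] with [A]
    free of [x], and [A n] is [HB_n(0) / n!] because [e^{xt}] is [1] at [x = 0].
    The series [e^t - 1] is [U * t] with [U] the inverse of [t / (e^t - 1)], so

      [A * e^{xt} = (U^r * A) * ((t / (e^t - 1))^r * e^{xt})].

    The last factor generates the Bernoulli polynomials of order [r], hence the
    connection coefficients are the binomial convolution of [HB_n(0)] with the
    sequence generated by [U^r] ([egf_coefM], [egf_coef_expt_shift_exp]).  As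
    [U^r * t^r = (e^t - 1)^r], that sequence is read off the classical expansion

      [(e^t - 1)^r = r! * \sum_n S_2(n, r) t^n / n!]   ([egf_coef_expt_subr1_exp]).

    Here [S_2(n, r)] counts set partitions.  Sorting the [k^n] maps from an
    [n]-set to a [k]-set by their partition into fibres gives
    [k^n = \sum_m S_2(n, m) m! 'C(k, m)] ([card_ffun_stirling2]), while
    expanding [e^{kt} = (1 + (e^t - 1))^k] gives the same identity with
    [n! [t^n] (e^t - 1)^m] in place of [S_2(n, m) m!].  The matrix
    ['C(k, m)] is unitriangular, so the two sequences agree. *)

(** * Set partitions and maps between finite sets *)

Section Fibres.
Context {T U : finType}.

Definition fibres (f : {ffun T -> U}) : {set {set T}} :=
  preim_partition f [set: T].

Lemma mem_pblock_fibres (f : {ffun T -> U}) x y :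
  (y \in pblock (fibres f) x) = (f x == f y).
Proof.
apply: pblock_equivalence_partition; rewrite ?inE // => a b c _ _ _.
by split=> // /eqP ->.
Qed.

(** A map constant on the blocks of [P] factors through [P], and its fibres are
    exactly the blocks when the factor is injective. *)
Lemma card_fibres (P : {set {set T}}) : finset.partition P [set: T] ->
  #|[set f : {ffun T -> U} | fibres f == P]| = (#|U| ^_ #|P|)%N.
Proof.
move=> partP; have [/eqP covP tiP nP] := and3P partP.
have inP x : pblock P x \in P by rewrite pblock_mem // covP inE.
have neP (B : {B | B \in P}) : exists x, x \in val B.
  by apply/set0Pn; apply: contraNneq nP => <-; apply: valP.
pose blk x : {B | B \in P} := exist _ (pblock P x) (inP x).
pose elt B := xchoose (neP B).
have blkE x (B : {B | B \in P}) : x \in val B -> blk x = B.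
  by move=> xB; apply: val_inj; rewrite /= (def_pblock tiP (valP B) xB).
have eltK B : blk (elt B) = B by apply/blkE/xchooseP.
pose pull (g : {ffun {B | B \in P} -> U}) := [ffun x => g (blk x)].
have pull_inj : injective pull.
  move=> g h /ffunP gh; apply/ffunP => B; have := gh (elt B).
  by rewrite !ffunE eltK.
have -> : #|P| = #|{: {B | B \in P}}| by rewrite card_sig.
rewrite -card_inj_ffuns -(card_imset _ pull_inj); congr #|pred_of_set _|.
apply/setP => f; rewrite inE; apply/eqP/imsetP => [fP|[g]].
  have eq_f x y : (f x == f y) = (blk x == blk y).
    by rewrite -mem_pblock_fibres fP -val_eqE /= eq_pblock ?covP ?inE //.
  exists [ffun B => f (elt B)].
    rewrite inE; apply/injectiveP => B C; rewrite !ffunE => /eqP.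
    by rewrite eq_f !eltK => /eqP.
  by apply/ffunP => x; rewrite !ffunE; apply/eqP; rewrite eq_f eltK.
rewrite inE => /injectiveP g_inj ->.
rewrite -[RHS](equivalence_partition_pblock partP).
apply: eq_in_imset => x _; apply/setP => y; rewrite !inE !ffunE.
by rewrite (inj_eq g_inj) -val_eqE /= eq_pblock ?covP ?inE //.
Qed.

End Fibres.

(** Maps with [m] fibres arise from each partition into [m] blocks through the
    [k ^_ m = 'C(k, m) * m!] injections of its blocks into the codomain. *)
Lemma card_ffun_stirling2 n k :
  (k ^ n = \sum_(m < k.+1) 'C(k, m) * (m`! * stirling2 n m))%N.
Proof.
have partF (f : {ffun 'I_n -> 'I_k}) : finset.partition (fibres f) [set: 'I_n].
  exact: preim_partitionP.
transitivity (\sum_(P : {set {set 'I_n}} | finset.partition P [set: 'I_n]) k ^_ #|P|)%N.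
  rewrite -{1}(card_ord n) -{1}(card_ord k) -card_ffun -sum1_card.
  rewrite (partition_big fibres (fun P => finset.partition P [set: 'I_n])) //.
  apply: eq_bigr => P partP.
  by rewrite sum1_card -cardsE card_fibres ?card_ord.
(* More than [k] blocks leave no injection into a [k]-set. *)
rewrite (bigID (fun P : {set {set 'I_n}} => #|P| < k.+1)%N) /= addnC big1 ?add0n; last first.
  by move=> P /andP[_]; rewrite -leqNgt => /ffact_small.
rewrite (partition_big (fun P : {set {set 'I_n}} => inord #|P| : 'I_k.+1) predT) //=.
apply: eq_bigr => m _; rewrite mulnA bin_ffact mulnC /stirling2 -sum1_card big_distrl /=.
apply: eq_big => [P|P /andP[/andP[_ ltPk] /eqP <-]].
  rewrite inE -andbA; congr (_ && _); apply/andP/eqP => [[ltPk /eqP <-]|->].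
    by rewrite inordK.
  by rewrite ltn_ord inord_val.
by rewrite mul1n inordK.
Qed.

(** The matrix ['C(k, m)] is unitriangular, hence injective. *)
Lemma binomial_transform_inj {V : zmodType} (a b : nat -> V) :
  (forall k, \sum_(m < k.+1) a m *+ 'C(k, m) = \sum_(m < k.+1) b m *+ 'C(k, m)) ->
  a =1 b.
Proof.
move=> ab k; elim/ltn_ind: k => k IHk; have := ab k.
rewrite !big_ord_recr /= binn !mulr1n.
rewrite (eq_bigr (fun m : 'I_k => b m *+ 'C(k, m))) => [/addrI //|m _].
by rewrite IHk.
Qed.

(** * Formal power series *)

Section Fps.
Variable A : comNzRingType.
Implicit Types f g : fps A.

Lemma fps_coefMn f m n : (f *+ m) n = f n *+ m.
Proof. by elim: m => [|m IHm]; rewrite ?fps_coef0 // !mulrS fps_coefD IHm. Qed.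

Lemma fps_coef_sum m (F : 'I_m -> fps A) n :
  (\sum_i F i) n = \sum_i F i n.
Proof.
by elim/big_rec2: _ => [|i x y _ <-]; rewrite ?fps_coef0 ?fps_coefD.
Qed.

Lemma fps_coefMtS f n : (f * fps_t) n.+1 = f n.
Proof.
rewrite fps_coefM 2!big_ord_recr /= subnn subSnn mulr0 addr0 mulr1.
rewrite big1 ?add0r // => i _.
by rewrite subSn ?(ltnW (ltn_ord i)) // eqSS subn_eq0 leqNgt ltn_ord mulr0.
Qed.

Lemma fps_coefMtXn f r n : (f * fps_t ^+ r) (n + r)%N = f n.
Proof.
by elim: r => [|r IHr]; rewrite ?mulr1 ?addn0 // exprSr mulrA addnS fps_coefMtS.
Qed.

Lemma fps_coef_tXn i n : ((fps_t : fps A) ^+ i) n = (n == i)%:R.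
Proof.
elim: i n => [|i IHi] [|n] //; last by rewrite exprSr fps_coefMtS IHi.
by rewrite exprSr fps_coefM big_ord1 mulr0.
Qed.

Lemma fps_comp_t f : fps_comp f fps_t = f.
Proof.
apply: fpsP => n /=; rewrite big_ord_recr /= fps_coef_tXn eqxx mulr1.
by rewrite big1 ?add0r // => i _; rewrite fps_coef_tXn gtn_eqF ?mulr0.
Qed.

Lemma fps_coef_constM a f n : (fps_const a * f) n = a * f n.
Proof.
rewrite fps_coefM big_ord_recl /= mulr1n subn0 big1 ?addr0 // => i _.
by rewrite mul0r.
Qed.

Lemma fps_coef_constXM a f i n : (fps_const a ^+ i * f) n = a ^+ i * f n.
Proof.
elim: i => [|i IHi]; first by rewrite !mul1r.
by rewrite !exprS -!mulrA fps_coef_constM IHi.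
Qed.

Lemma egf_coefM f g n :
  egf_coef (f * g) n = \sum_(i < n.+1) (egf_coef f i * egf_coef g (n - i)%N) *+ 'C(n, i).
Proof.
rewrite /egf_coef fps_coefM -sumrMnl; apply: eq_bigr => i _.
have le_in : (i <= n)%N by rewrite -ltnS.
by rewrite mulrnAl mulrnAr -!mulrnA -(bin_fact le_in); congr (_ *+ _); lia.
Qed.

End Fps.

Lemma fps_map_polyCM (A : comNzRingType) (f g : fps A) :
  fps_map polyC (f * g) = fps_map polyC f * fps_map polyC g.
Proof.
apply: fpsP => n; rewrite fps_coefM [LHS]/= rmorph_sum /=.
by apply: eq_bigr => i _; rewrite polyCM.
Qed.

(** * The exponential series *)

Section Exponential.
Variable R : realType.

Lemma coef_exp_xt_at0 n : (exp_xt R n).[0] = (n == 0)%N%:R.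
Proof.
rewrite /= big_ord_recl /= fact0 invr1 mul1r.
rewrite hornerD horner_sum big1 ?addr0 => [|i _].
  by case: eqP => _; rewrite ?hornerE.
rewrite exprMn fps_coef_constXM !hornerM hornerXn expr0n /=.
by rewrite mul0r mulr0.
Qed.

Lemma egf_coef_expt n : egf_coef (expt R) n = 1.
Proof. by rewrite /egf_coef /= -[_ *+ _]mulr_natr mulVf // pnatr_eq0 -lt0n fact_gt0. Qed.

Lemma egf_coef_expt_exp k n : egf_coef (expt R ^+ k) n = (k ^ n)%:R.
Proof.
elim: k n => [|k IHk] n.
  by rewrite /egf_coef expr0 fps_coef1; case: n => [|n]; rewrite ?mul0rn // exp0n.
rewrite exprSr egf_coefM -(add1n k) expnDn natr_sum; apply: eq_bigr => i _.
by rewrite IHk egf_coef_expt mulr1 exp1n mul1n mulnC natrM mulr_natr.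
Qed.

(** Both sides have the same binomial transform in [m], namely [k^n]. *)
Lemma egf_coef_expt_subr1_exp m n :
  egf_coef ((expt R - 1) ^+ m) n = (m`! * stirling2 n m)%:R.
Proof.
move: m; apply: binomial_transform_inj => k; transitivity ((k ^ n)%:R : R).
  have exptE : expt R = 1 + (expt R - 1) by rewrite addrC subrK.
  rewrite -egf_coef_expt_exp [in RHS]exptE exprDn /egf_coef fps_coef_sum -sumrMnl.
  by apply: eq_bigr => i _; rewrite expr1n mul1r fps_coefMn mulrnAC.
rewrite card_ffun_stirling2 natr_sum; apply: eq_bigr => i _.
by rewrite natrM mulr_natl.
Qed.

(** [(e^t - 1) / t], the inverse of the generating series of the Bernoulli
    numbers. *)
Definition expt_shift : fps R := Fps (fun n => expt R n.+1).

Lemma expt_shiftMt : expt_shift * fps_t = expt R - 1.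
Proof.
apply: fpsP => -[|n]; last by rewrite fps_coefMtS fps_coefD fps_coefN subr0.
rewrite fps_coefM big_ord1 mulr0 fps_coefD fps_coefN fps_coef1 /=.
by rewrite fact0 invr1 subrr.
Qed.

Lemma bernoulli_quot_expt_shift :
  fps_div fps_t (fps_exp fps_t - 1) * expt_shift = 1 :> fps R.
Proof.
have t1 : (fps_t : fps R) 1%N != 0 by exact: oner_neq0.
have t0 : (fps_t : fps R) 0%N = 0 by [].
apply: (fps_mul_inj t0 t1).
rewrite -mulrA expt_shiftMt mul1r -[RHS](bernoulli_quotK R).
by rewrite [in X in _ = _ * X]/fps_exp fps_comp_t.
Qed.

(** [(e^t - 1)^r] shifted down by [r]; the factor [r!] of the Stirling expansion
    and the change from [(l + r)!] to [l!] combine into a binomial. *)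
Lemma egf_coef_expt_shift_exp r l :
  egf_coef (expt_shift ^+ r) l = (stirling2 (l + r) r)%:R / 'C(l + r, r)%:R.
Proof.
have := egf_coef_expt_subr1_exp r (l + r).
rewrite -expt_shiftMt exprMn /egf_coef fps_coefMtXn.
have := bin_fact (leq_addl l r); rewrite addnK => <-.
set u := fps_coef _ l; rewrite -!(mulr_natr u) !natrM => eq_r.
have r_neq0 : r`!%:R != 0 :> R by rewrite pnatr_eq0 -lt0n fact_gt0.
have b_neq0 : 'C(l + r, r)%:R != 0 :> R by rewrite pnatr_eq0 -lt0n bin_gt0 leq_addl.
by apply/(canRL (mulfK b_neq0))/(mulfI r_neq0); rewrite -eq_r; ring.
Qed.

End Exponential.

(** * The connection formula *)

Lemma hermite_polyBernoulli_num_egf (R : realType) (nu : R) (k : int) (f : fps R) n :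
  hermite_polyBernoulli_gf nu k = fps_map polyC f * exp_xt R ->
  hermite_polyBernoulli_num nu k n = egf_coef f n.
Proof.
rewrite /hermite_polyBernoulli_num /hermite_polyBernoulli /egf_coef => ->.
rewrite hornerMn fps_coefM horner_sum big_ord_recr /= subnn big1 => [|i _].
  by rewrite add0r hornerM coef_exp_xt_at0 hornerC mulr1.
by rewrite hornerM coef_exp_xt_at0 subn_eq0 leqNgt ltn_ord mulr0.
Qed.

Theorem theorem10 (R : realType) (k : int) (nu : R) (hnu : nu != 0)
    (n r : nat) :
  hermite_polyBernoulli nu k n =
  \sum_(0 <= m < n.+1)
    ('C(n, m)%:R *
     \sum_(0 <= l < (n - m).+1)
       'C(n - m, l)%:R / 'C(l + r, r)%:R * (stirling2 (l + r) r)%:R *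
       hermite_polyBernoulli_num nu k (n - m - l)) *:
    bernoulli_poly R r m.
Proof.
rewrite /hermite_polyBernoulli /hermite_polyBernoulli_gf.
set f := (X in fps_map polyC X).
have -> : fps_map polyC f * exp_xt R =
    bernoulli_gf R r * fps_map polyC (expt_shift R ^+ r * f).
  rewrite /bernoulli_gf mulrAC -fps_map_polyCM mulrA -exprMn.
  by rewrite bernoulli_quot_expt_shift expr1n mul1r.
rewrite egf_coefM big_mkord; apply: eq_bigr => m _.
rewrite -mulr_natl mulrCA -/(bernoulli_poly R r m).
have -> (g : fps R) i : egf_coef (fps_map polyC g) i = (egf_coef g i)%:P.
  by rewrite /egf_coef polyCMn.
rewrite -polyC_natr -polyCM mulrC mul_polyC; congr (_ * _ *: _).
rewrite egf_coefM big_mkord; apply: eq_bigr => l _.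
rewrite egf_coef_expt_shift_exp (@hermite_polyBernoulli_num_egf _ nu k f) //.
by rewrite -mulr_natl; ring.
Qed.
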